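(* Let $k\geq 3$ be an odd integer and let $G$ be a connected graph of even order $n\geq 4$. (i) If $n\geq 10$ and $\lambda_1(D(G))\le \lambda_1(D(K_1\vee(K_{n-2}\cup K_1)))$, then $G$ is $\mathrm{GBC}_k$ unless $G\cong K_1\vee(K_{n-2}\cup K_1)$. (ii) If $4\le n\le 8$ and $\lambda_1(D(G))\le \lambda_1(D(S_{n,\frac{n}{2}}))$, then $G$ is $\mathrm{GBC}_k$ unless $G\cong S_{n,\frac{n}{2}}$.
   Context: All graphs are finite, simple, undirected. For a connected graph $G$, $D(G)$ is its distance matrix (entry $(i,j)$ is the distance between $v_i$ and $v_j$) and $\lambda_1(D(G))$ its largest eigenvalue. $G\cup H$ is disjoint union, $G\vee H$ the join, $tK_1$ the edgeless graph on $t$ vertices, $S_{n,k}=K_k\vee(n-k)K_1$. For a graph $H$, $i(H)$ is the number of isolated vertices of $H$ and $\mathrm{odd}(H)$ the number of components of $H$ with an odd number ($\ge 3$) of vertices. The $k$-Berge–Tutte formula is $\mathrm{def}_k(G)=\max_{S\subseteq V(G)} \big(k\, i(G-S)-k|S|\big)$ if $k$ is even, and $\max_{S\subseteq V(G)}\big(\mathrm{odd}(G-S)+k\, i(G-S)-k|S|\big)$ if $k$ is odd; a set $S$ attaining the maximum is a $k$-barrier. A connected graph of even order is $\mathrm{GBC}_k$ (generalized bicritical about integer $k$-matching) if it has no non-empty $k$-barrier. *)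

(* Defs.v *)
From HB Require Import structures.
From mathcomp Require Import all_boot all_order all_algebra.
From mathcomp Require Import reals.
Set Implicit Arguments. Unset Strict Implicit. Unset Printing Implicit Defensive.
Import Order.TTheory GRing.Theory Num.Theory.

(* A simple graph on a finite vertex type T is a symmetric irreflexive
   relation e : rel T (the hypotheses are stated in the theorem). *)

Definition connected_graph (T : finType) (e : rel T) : Prop :=
  forall x y : T, connect e x y.

Fixpoint ball (T : finType) (e : rel T) (x : T) (k : nat) : {set T} :=
  match k with
  | 0 => [set x]
  | k'.+1 => ball e x k' :|: [set y | [exists z in ball e x k', e z y]]
  end.

(* Graph distance: least k with y within distance k of x
   (for connected graphs this is always < #|T|). *)
Definition gdist (T : finType) (e : rel T) (x y : T) : nat :=
  find (fun k => y \in ball e x k) (iota 0 #|T|).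

Definition distmx (R : realType) (T : finType) (e : rel T) : 'M[R]_#|T| :=
  \matrix_(i, j) ((gdist e (enum_val i) (enum_val j))%:R)%R.

(* Largest eigenvalue of a square real matrix (the supremum of its (finite)
   set of real eigenvalues; for symmetric matrices this is the max). *)
Definition lambda1 (R : realType) (m : nat) (A : 'M[R]_m) : R :=
  sup (fun a : R => eigenvalue A a).

Definition iso_graph (T : finType) (e : rel T) (n : nat) (h : rel 'I_n) : Prop :=
  exists f : T -> 'I_n, bijective f /\ forall x y, h (f x) (f y) = e x y.

(* K_1 v (K_{n-2} u K_1) on 'I_n: vertex 0 is the joined K_1, vertex n-1 is the
   isolated K_1 of the union, vertices 1..n-2 form K_{n-2}. *)
Definition KK_graph (n : nat) : rel 'I_n :=
  fun x y => (x != y) &&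
    ~~ (((val x == n.-1) && (val y != 0%N)) || ((val y == n.-1) && (val x != 0%N))).

(* S_{n,k} = K_k v (n-k)K_1 on 'I_n: vertices < k form the clique. *)
Definition S_graph (n k : nat) : rel 'I_n :=
  fun x y => (x != y) && ((val x < k) || (val y < k)).

Definition delS (T : finType) (e : rel T) (S : {set T}) : rel T :=
  fun x y => [&& e x y, x \notin S & y \notin S].

Definition comps (T : finType) (e : rel T) (S : {set T}) : {set {set T}} :=
  [set [set y | (y \notin S) && connect (delS e S) x y] | x in ~: S].

Definition iso_count (T : finType) (e : rel T) (S : {set T}) : nat :=
  #|[set x | (x \notin S) && [forall y, (y \notin S) ==> ~~ e x y]]|.

Definition odd_count (T : finType) (e : rel T) (S : {set T}) : nat :=
  #|[set C in comps e S | odd #|C| && (3 <= #|C|)]|.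

(* The quantity maximized in the k-Berge-Tutte formula. *)
Definition bt_value (k : nat) (T : finType) (e : rel T) (S : {set T}) : int :=
  if odd k then ((odd_count e S)%:Z + (k * iso_count e S)%:Z - (k * #|S|)%:Z)%R
  else ((k * iso_count e S)%:Z - (k * #|S|)%:Z)%R.

Definition k_barrier (k : nat) (T : finType) (e : rel T) (S : {set T}) : Prop :=
  forall S' : {set T}, (bt_value k e S' <= bt_value k e S)%R.

Definition GBC (k : nat) (T : finType) (e : rel T) : Prop :=
  [/\ connected_graph e, ~~ odd #|T| &
      forall S : {set T}, S != set0 -> ~ k_barrier k e S].

Arguments KK_graph n : clear implicits.
Arguments S_graph n k : clear implicits.

(* Main.v *)
Require Import Defs.
From mathcomp Require Import all_boot all_order all_algebra.
From mathcomp Require Import reals complex spectral sesquilinear.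
From mathcomp Require Import zify ring lra.
Import Order.TTheory GRing.Theory Num.Theory.
Set Implicit Arguments.
Unset Strict Implicit.

(** A non-empty barrier S satisfies [k|S| <= odd(G-S) + k i(G-S)], because the
    empty set has nonnegative value. This forces many non-adjacent pairs of
    vertices, hence many distances at least 2, and the Rayleigh quotient of the
    all-ones vector bounds lambda_1(D(G)) from below by n - 1 + W/n, where W is
    the number of ordered non-adjacent pairs. The bound exceeds the eigenvalue
    of the extremal graph, which is bounded from above by an explicit positive
    vector v with D v <= mu v, except when |S| = 1 and S isolates a vertex, or
    when S consists of half of the vertices and isolates the other half. Then G
    is a spanning subgraph of K_1 v (K_{n-2} u K_1), resp. of S_{n,n/2}, and
    lambda_1 is strictly monotone in the distances. For n = 8 and |S| = 1 the
    all-ones vector is not enough: lambda_1 of K_1 v (K_6 u K_1), about 8.778,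
    barely exceeds that of S_{8,4}, about 8.772. *)

(** * The largest eigenvalue of a symmetric matrix *)

Section SpectralMax.
Local Open Scope ring_scope.
Local Open Scope sesquilinear_scope.

Local Notation toC := (real_complex _).

(** Over the complex extension [A] is Hermitian, hence unitarily diagonalisable with real diagonal.
    In the eigenbasis both quadratic forms are weighted sums of the same squared moduli, so the
    largest diagonal entry serves as [r]. *)
Lemma symmetric_spectral_max (R : rcfType) (n : nat) (A : 'M[R]_n) :
  (0 < n)%N -> A^T = A ->
  exists2 r, eigenvalue A r &
    forall z : 'rV_n, (z *m A *m z^T) 0 0 <= r * (z *m z^T) 0 0.
Proof.
move=> n_gt0 symA; pose AC := map_mx (real_complex R) A; pose P := spectralmx AC.
have conj_toC a : (toC a)^* = toC a.
  by apply/CrealP/complex_realP; exists a.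
have hermAC : AC \is hermsymmx.
  apply: realsym_hermsym.
    apply/is_hermitianmxP; rewrite expr0 scale1r.
    by apply/matrixP=> i j; rewrite !mxE -{1}symA !mxE.
  by apply/mxOverP=> i j; rewrite !mxE; apply/complex_realP; exists (A i j).
have /hermitian_normalmx/orthomx_spectralP AE := hermAC.
have Du := hermitian_spectral_diag_real hermAC.
have [r rE] : exists r : 'I_n -> R, forall i, spectral_diag AC 0 i = toC (r i).
  exists (fun i => complex.Re (spectral_diag AC 0 i)) => i.
  by rewrite RRe_real //; apply: (mxOverP Du).
have Pu : P \is unitarymx := spectral_unitarymx AC.
have Punit : P \in unitmx := spectral_unit AC.
have [i0 _ rmax] := @arg_maxP _ R 'I_n (Ordinal n_gt0) predT r isT.
exists (r i0).
  (* Being an eigenvalue is invariant under the field embedding, so a complex eigenvector is enough: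
     row [i0] of the unitary matrix [P]. *)
  suff ev : eigenvalue AC (toC (r i0)).
    exact: etrans (esym (eigenvalue_map (real_complex R) A (r i0))) ev.
  rewrite -rE; apply/eigenvalueP; exists (row i0 P).
    have PA : P *m AC = diag_mx (spectral_diag AC) *m P.
      by rewrite {1}AE -/P !mulmxA mulmxV // mul1mx.
    by rewrite -[LHS]row_mul PA; apply/rowP=> j; rewrite mul_diag_mx !mxE.
  by apply: contraTneq Punit => P0; rewrite -row_free_unit;
    apply/row_freePn; exists i0; rewrite P0 sub0mx.
move=> z; rewrite -(lecR (R:=R)) rmorphM /=.
pose zC := map_mx (real_complex R) z; pose w := zC *m P^t*.
have zCE : zC^T = zC^t* by apply/matrixP=> i j; rewrite !mxE conj_toC.
have -> : toC ((z *m A *m z^T) 0 0) = \sum_i toC (r i) * `|w 0 i| ^+ 2.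
  transitivity ((w *m diag_mx (spectral_diag AC) *m w^t*) 0 0).
    have -> : toC ((z *m A *m z^T) 0 0) = map_mx toC (z *m A *m z^T) 0 0.
      by rewrite [RHS]mxE.
    rewrite !map_mxM /= -/AC -(map_trmx (real_complex R) z) -/zC zCE {1}AE.
    rewrite invmx_unitary // -/P.
    by rewrite /w trmx_mul map_mxM /= trmxCK !mulmxA.
  rewrite mxE; apply: eq_bigr => i _.
  by rewrite mul_mx_diag !mxE rE normCK mulrAC mulrC.
have -> : toC ((z *m z^T) 0 0) = \sum_i `|w 0 i| ^+ 2.
  transitivity ((w *m w^t*) 0 0).
    have -> : toC ((z *m z^T) 0 0) = map_mx toC (z *m z^T) 0 0 by rewrite [RHS]mxE.
    rewrite !map_mxM /= -(map_trmx (real_complex R) z) -/zC zCE /w trmx_mul map_mxM /= trmxCK.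
    by rewrite mulmxA mulmxKtV.
  by rewrite mxE; apply: eq_bigr => i _; rewrite !mxE normCK.
rewrite mulr_sumr; apply: ler_sum => i _; apply: ler_wpM2r.
  by rewrite exprn_ge0.
by rewrite lecR; apply: rmax.
Qed.

End SpectralMax.

(** * Variational bounds and strict monotonicity for the largest eigenvalue *)

Section LargestEigenvalue.
Local Open Scope ring_scope.
Variable R : realType.

Lemma sum_enum_val (T : finType) (F : T -> R) :
  \sum_x F x = \sum_(i < #|T|) F (enum_val i).
Proof. by rewrite (reindex _ (onW_bij _ (@enum_val_bij T))). Qed.

Definition funmx (T : finType) (d : T -> T -> R) : 'M[R]_#|T| :=
  \matrix_(i, j) d (enum_val i) (enum_val j).

Section Sym.
Variables (T : finType) (d : T -> T -> R).
Hypotheses (T_gt0 : (0 < #|T|)%N) (dC : forall x y, d x y = d y x).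
Local Notation L := (lambda1 (funmx d)).

(** The supremum is the [r] of the spectral bound: [r] is itself an eigenvalue, and the bound tested
    on an eigenvector of any eigenvalue [a] gives [a <= r]. *)
Lemma lambda1_funmx :
  eigenvalue (funmx d) L /\
  forall z : 'rV_#|T|, (z *m funmx d *m z^T) 0 0 <= L * (z *m z^T) 0 0.
Proof.
have symA : (funmx d)^T = funmx d by apply/matrixP=> i j; rewrite !mxE dC.
have [r ev Ray] := symmetric_spectral_max T_gt0 symA.
suff -> : L = r by [].
have ub : classical_sets.ubound (fun a : R => eigenvalue (funmx d) a) r.
  move=> a /eigenvalueP[v vE /rV0Pn[i vi]]; have := Ray v.
  rewrite vE -scalemxAl [leLHS]mxE ler_pM2r //.
  rewrite mxE (bigD1 i) //= ltr_pwDl //.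
    by rewrite mxE -expr2 exprn_even_gt0.
  by apply: sumr_ge0 => j _; rewrite mxE -expr2 sqr_ge0.
apply/eqP; rewrite eq_le; apply/andP; split; first by apply: ge_sup => //; exists r.
by apply: ub_le_sup => //; exists r.
Qed.

Lemma rayleigh (z : T -> R) :
  \sum_x \sum_y d x y * z x * z y <= L * \sum_x z x ^+ 2.
Proof.
pose w : 'rV[R]_#|T| := \row_i z (enum_val i); have [_ /(_ w)] := lambda1_funmx.
have -> : (w *m w^T) 0 0 = \sum_x z x ^+ 2.
  by rewrite mxE [RHS]sum_enum_val; apply: eq_bigr => i _; rewrite !mxE.
suff -> : (w *m funmx d *m w^T) 0 0 = \sum_x \sum_y d x y * z x * z y by [].
rewrite mxE exchange_big [RHS]sum_enum_val; apply: eq_bigr => j _ /=.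
rewrite mxE [RHS]sum_enum_val mulr_suml; apply: eq_bigr => i _.
by rewrite !mxE mulrAC mulrC mulrA mulrAC.
Qed.

Lemma lambda1_eigenfun :
  exists2 v : T -> R, exists x, v x != 0 & forall y, \sum_x d y x * v x = L * v y.
Proof.
have [/eigenvalueP[v vE v0] _] := lambda1_funmx.
exists (fun x => v 0 (enum_rank x)).
  have /rV0Pn[i vi] := v0; by exists (enum_val i); rewrite enum_valK.
move=> y; have /rowP/(_ (enum_rank y)) := vE; rewrite !mxE => <-.
rewrite sum_enum_val; apply: eq_bigr => i _.
by rewrite !mxE enum_rankK enum_valK dC mulrC.
Qed.

(** Collatz-Wielandt bound: read the equation of an eigenfunction [u] at a vertex that maximises
    [|u| / v]. *)
Lemma lambda1_le (v : T -> R) mu :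
  (forall x, 0 < v x) -> (forall x y, 0 <= d x y) ->
  (forall x, \sum_y d x y * v y <= mu * v x) -> L <= mu.
Proof.
move=> v_gt0 d_ge0 vE; have [u [x0 ux0] uE] := lambda1_eigenfun.
have [x _ xmax] := @arg_maxP _ R T x0 predT (fun x => `|u x| / v x) isT.
have ux : 0 < `|u x|.
  have := xmax x0 isT; rewrite /= => le.
  have : 0 < `|u x| / v x by apply: lt_le_trans le; rewrite divr_gt0 ?normr_gt0.
  by rewrite pmulr_lgt0 ?invr_gt0.
(* A negative [L] is treated apart, since taking absolute values in the eigenvalue equation bounds
   only [|L|]; the row inequality gives [mu >= 0] there. *)
rewrite -(ler_pM2r ux); have [L0|L0] := lerP 0 L; last first.
  have : L * `|u x| <= 0 by rewrite pmulr_lle0 // ltW.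
  move/le_trans; apply; rewrite mulr_ge0 ?normr_ge0 //.
  have : 0 <= mu * v x.
    by apply: le_trans (vE x); apply: sumr_ge0 => y _; rewrite mulr_ge0 // ltW.
  by rewrite pmulr_lge0.
rewrite -{1}(ger0_norm L0) -normrM -uE.
apply: le_trans (ler_norm_sum _ _ _) _.
apply: (@le_trans _ _ ((\sum_y d x y * v y) * (`|u x| / v x))).
  rewrite mulr_suml; apply: ler_sum => y _.
  rewrite normrM (ger0_norm (d_ge0 _ _)) -mulrA ler_wpM2l //.
  by have := xmax y isT; rewrite /= ler_pdivrMr // mulrC.
apply: le_trans (ler_wpM2r _ (vE x)) _; first by rewrite divr_ge0 // ltW.
by rewrite mulrACA mulrA mulfK ?gt_eqF // -mulrA [v x * _]mulrC.
Qed.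

Lemma lambda1_ge (v : T -> R) mu :
  (forall x, 0 < v x) -> (forall x, mu * v x <= \sum_y d x y * v y) -> mu <= L.
Proof.
move=> v_gt0 vE; have S : 0 < \sum_x v x ^+ 2.
  have [x0 _] := card_gt0P T_gt0; rewrite (bigD1 x0) //= ltr_pwDl ?exprn_gt0 //.
  by apply: sumr_ge0 => y _; rewrite sqr_ge0.
rewrite -(ler_pM2r S); apply: le_trans (rayleigh v).
rewrite mulr_sumr; apply: ler_sum => x _.
rewrite expr2 mulrA; apply: le_trans (ler_wpM2r (ltW (v_gt0 x)) (vE x)) _.
rewrite mulr_suml; apply: ler_sum => y _.
by rewrite -!mulrA [v y * _]mulrC.
Qed.

(* Equality in the Rayleigh bound makes the quadratic form of L - d, which is
   nonnegative, vanish at z; its polarisation at z then vanishes too. *)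
Lemma rayleigh_eq (z : T -> R) :
  L * (\sum_x z x ^+ 2) <= \sum_x \sum_y d x y * z x * z y ->
  forall x, \sum_y d x y * z y = L * z x.
Proof.
move=> zE x0; set g := \sum_y d x0 y * z y - L * z x0.
suff g0 : g = 0 by apply/eqP; rewrite -subr_eq0 -/g g0.
have key t : 2 * t * g <= (L - d x0 x0) * t ^+ 2.
  pose w x := z x + t * (x == x0)%:R.
  have pick (F : T -> R) : \sum_y F y * (y == x0)%:R = F x0.
    rewrite (bigD1 x0) //= eqxx mulr1 big1 ?addr0 // => y /negPf->.
    by rewrite mulr0.
  have w2 : \sum_x w x ^+ 2 = \sum_x z x ^+ 2 + 2 * t * z x0 + t ^+ 2.
    rewrite -[2 * t * z x0](pick (fun x => 2 * t * z x)).
    rewrite -[t ^+ 2](pick (fun=> t ^+ 2)) -!big_split /=; apply: eq_bigr => x _.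
    by rewrite /w; case: (x == x0); rewrite /=; ring.
  have dw x : \sum_y d x y * w y = \sum_y d x y * z y + t * d x x0.
    rewrite -[d x x0](pick (fun y => d x y)) mulr_sumr -big_split /=.
    by apply: eq_bigr => y _; rewrite /w; ring.
  have wdw : \sum_x \sum_y d x y * w x * w y
      = \sum_x \sum_y d x y * z x * z y + 2 * t * (\sum_y d x0 y * z y)
        + t ^+ 2 * d x0 x0.
    transitivity (\sum_x w x * (\sum_y d x y * w y)).
      by apply: eq_bigr => x _; rewrite mulr_sumr; apply: eq_bigr => y _; ring.
    transitivity (\sum_x (z x * (\sum_y d x y * z y) + t * (d x0 x * z x)
       + (t * ((\sum_y d x y * z y) + t * d x x0)) * (x == x0)%:R)).
      apply: eq_bigr => x _; rewrite dw /w (dC x x0); ring.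
    rewrite !big_split /= pick -mulr_sumr.
    rewrite (eq_bigr (fun x => \sum_y d x y * z x * z y)); last first.
      by move=> x _; rewrite mulr_sumr; apply: eq_bigr => y _; ring.
    by ring.
  have := rayleigh w; rewrite wdw w2 /g; move: zE.
  set A := \sum_x \sum_y _; set B := \sum_x _; set C := \sum_y _.
  by move=> h1 h2; lra.
set c := L - d x0 x0 in key.
(* This [t] turns [key] into [2 g^2 / (|c| + 1) <= g^2 / (|c| + 1)], which forces [g = 0]; the added
   1 keeps the denominator positive. *)
have h1 := key (g / (`|c| + 1)).
apply/eqP; rewrite -sqrf_eq0 eq_le sqr_ge0 andbT.
have p : 0 < `|c| + 1 by rewrite ltr_wpDl.
have := ler_norm c => cle.
have : 2 * (g / (`|c| + 1)) * g <= (`|c| + 1) * (g / (`|c| + 1)) ^+ 2.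
  apply: le_trans h1 _; apply: ler_wpM2r; first by rewrite sqr_ge0.
  by lra.
have -> : (`|c| + 1) * (g / (`|c| + 1)) ^+ 2 = (g / (`|c| + 1)) * g.
  by field; lra.
have -> : 2 * (g / (`|c| + 1)) * g = (g ^+ 2 / (`|c| + 1)) *+ 2.
  by field; lra.
have -> : (g / (`|c| + 1)) * g = g ^+ 2 / (`|c| + 1) by field; lra.
rewrite mulr2n gerDl pmulr_lle0 // invr_gt0 //.
Qed.
End Sym.

(** Perron-Frobenius argument: the absolute value [y] of an eigenfunction of [d'] satisfies
    [L' |y|^2 <= y d' y <= y d y <= L |y|^2]. If the ends agree, [y] is an eigenfunction of [d],
    hence positive, and the vanishing sum of the nonnegative terms [(d - d') y y] gives equality
    entrywise. *)
Lemma lambda1_lt_mono (T T' : finType) (d : T -> T -> R) (d' : T' -> T' -> R)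
    (f : T' -> T) :
  bijective f -> (0 < #|T|)%N ->
  (forall x y, d x y = d y x) -> (forall x y, d' x y = d' y x) ->
  (forall x y, 0 <= d' x y) -> (forall x y, x != y -> 0 < d x y) ->
  (forall x y, d' x y <= d (f x) (f y)) ->
  lambda1 (funmx d') <= lambda1 (funmx d) /\
  (lambda1 (funmx d) <= lambda1 (funmx d') -> forall x y, d' x y = d (f x) (f y)).
Proof.
move=> bf T_gt0 dC d'C d'0 dpos dd'.
have T'_gt0 : (0 < #|T'|)%N by rewrite (bij_eq_card bf).
have [u [x0 ux0] uE] := lambda1_eigenfun T'_gt0 d'C.
set L' := lambda1 (funmx d') in uE *; set L := lambda1 (funmx d).
have [g fK gK] := bf.
pose y x := `|u (g x)|.
have reix (F : T -> R) : \sum_x F x = \sum_x F (f x).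
  by rewrite (reindex _ (onW_bij _ bf)).
have yf x : y (f x) = `|u x| by rewrite /y fK.
have low : L' * \sum_x y x ^+ 2 <= \sum_x \sum_z d' x z * y (f x) * y (f z).
  rewrite reix mulr_sumr; apply: ler_sum => x _.
  rewrite yf expr2 mulrA.
  have -> : \sum_z d' x z * `|u x| * y (f z) = (\sum_z d' x z * `|u z|) * `|u x|.
    by rewrite mulr_suml; apply: eq_bigr => z _; rewrite yf mulrAC.
  apply: ler_wpM2r => //; apply: le_trans (ler_norm _) _.
  rewrite normrM normr_id -normrM -uE; apply: le_trans (ler_norm_sum _ _ _) _.
  by apply: ler_sum => z _; rewrite normrM (ger0_norm (d'0 _ _)).
have mid : \sum_x \sum_z d' x z * y (f x) * y (f z)
        <= \sum_x \sum_z d x z * y x * y z.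
  rewrite [leRHS]reix; apply: ler_sum => x _; rewrite [leRHS]reix.
  by apply: ler_sum => z _; rewrite !ler_wpM2r ?normr_ge0.
have up := rayleigh T_gt0 dC y; rewrite -/L in up.
have y0 : 0 < \sum_x y x ^+ 2.
  rewrite (bigD1 (f x0)) //= ltr_pwDl //.
    by rewrite exprn_gt0 // yf normr_gt0.
  by apply: sumr_ge0 => z _; rewrite sqr_ge0.
split=> [|LL'].
  by rewrite -(ler_pM2r y0); apply: le_trans low (le_trans mid up).
have LE : L = L'.
  by apply/eqP; rewrite eq_le LL' -(ler_pM2r y0); apply: le_trans low (le_trans mid up).
have eqL : L * (\sum_x y x ^+ 2) <= \sum_x \sum_z d x z * y x * y z.
  by rewrite LE; apply: le_trans low mid.
have yE := rayleigh_eq T_gt0 dC eqL.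
(* A zero of [y] at [x] would make the row sum at [x] vanish, although its term at [f x0] is
   positive. *)
have ypos x : 0 < y x.
  rewrite lt_neqAle normr_ge0 andbT eq_sym; apply/eqP => yx0.
  have := yE x; rewrite yx0 mulr0 => /eqP; apply/negP; rewrite gt_eqF //.
  have xf : f x0 != x.
    by apply: contra_neq ux0 => fx; move: yx0; rewrite -fx yf => /normr0_eq0.
  rewrite (bigD1 (f x0)) //= ltr_pwDl //.
    by rewrite mulr_gt0 ?dpos 1?eq_sym // yf normr_gt0.
  apply: sumr_ge0 => z _; have [->|zx] := eqVneq x z; last first.
    by rewrite mulr_ge0 ?normr_ge0 // ltW // dpos.
  by have := dd' (g z) (g z); rewrite gK => /(le_trans (d'0 _ _)) h;
    rewrite mulr_ge0 ?normr_ge0.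
have eqs : \sum_x \sum_z (d (f x) (f z) - d' x z) * y (f x) * y (f z) = 0.
  apply/eqP; rewrite eq_le; apply/andP; split; last first.
    apply: sumr_ge0 => x _; apply: sumr_ge0 => z _.
    by rewrite !mulr_ge0 ?normr_ge0 // subr_ge0.
  have -> : \sum_x \sum_z (d (f x) (f z) - d' x z) * y (f x) * y (f z) =
    \sum_x \sum_z d x z * y x * y z - \sum_x \sum_z d' x z * y (f x) * y (f z).
    rewrite reix -sumrB; apply: eq_bigr => x _; rewrite reix -sumrB.
    by apply: eq_bigr => z _; ring.
  by rewrite subr_le0; apply: le_trans up _; rewrite LE.
move=> x z; apply/eqP; rewrite eq_sym -subr_eq0.
have nn x' z' : 0 <= (d (f x') (f z') - d' x' z') * y (f x') * y (f z').
  by rewrite !mulr_ge0 ?normr_ge0 // subr_ge0.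
have := eqs; move/eqP; rewrite psumr_eq0; last first.
  by move=> x' _; apply: sumr_ge0.
move=> /allP/(_ x (mem_index_enum _)); rewrite /= psumr_eq0 //.
move=> /allP/(_ z (mem_index_enum _)); rewrite /= !mulf_eq0.
by rewrite !(gt_eqF (ypos _)) !orbF.
Qed.

End LargestEigenvalue.

(** * Distances and components *)

Section Distance.
Variables (T : finType) (e : rel T).

Lemma mem_ballS x y k : y \in ball e x k -> y \in ball e x k.+1.
Proof. by move=> yk; rewrite /= inE yk. Qed.

Lemma ball_step x y z k : z \in ball e x k -> e z y -> y \in ball e x k.+1.
Proof.
by move=> zk zy; rewrite /= inE inE; apply/orP; right; apply/existsP; exists z; rewrite zk.
Qed.

Lemma ball_cons x y z k : e x z -> y \in ball e z k -> y \in ball e x k.+1.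
Proof.
move=> xz; elim: k y => [y|k IH y].
  by rewrite inE => /eqP ->; apply: ball_step xz; rewrite inE.
rewrite /= inE => /orP[/IH/mem_ballS //|]; rewrite inE => /existsP[w /andP[/IH wk wy]].
exact: ball_step wk wy.
Qed.

Lemma ball_sym : symmetric e -> forall x y k, (y \in ball e x k) = (x \in ball e y k).
Proof.
move=> eC; suff ball_sym1 x y k : y \in ball e x k -> x \in ball e y k.
  by move=> x y k; apply/idP/idP; apply: ball_sym1.
elim: k y => [y|k IH y]; first by rewrite !inE eq_sym.
rewrite [X in X -> _]/= inE => /orP[/IH/mem_ballS //|].
rewrite inE => /existsP[w /andP[/IH wk wy]].
by apply: ball_cons wk; rewrite eC.
Qed.

Lemma gdistC : symmetric e -> forall x y, gdist e x y = gdist e y x.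
Proof. by move=> eC x y; apply: eq_find => k; apply: ball_sym. Qed.

Lemma gdist_le x y k : (k < #|T|)%N -> y \in ball e x k -> (gdist e x y <= k)%N.
Proof.
move=> kT yk; rewrite leqNgt; apply/negP => /(before_find 0).
by rewrite nth_iota // add0n yk.
Qed.

(** When no ball reaches [y], [find] returns the length [#|T|]; the hypothesis [k <= #|T|] covers
    this default. *)
Lemma gdist_ge x y k :
  (k <= #|T|)%N -> (forall j, (j < k)%N -> y \notin ball e x j) -> (k <= gdist e x y)%N.
Proof.
move=> kT yk; rewrite leqNgt; apply/negP => lt.
have le : (gdist e x y < size (iota 0 #|T|))%N by rewrite size_iota (leq_trans lt).
have := le; rewrite /gdist -has_find => /(nth_find 0).
rewrite -/(gdist e x y) nth_iota ?add0n; last by rewrite size_iota in le.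
by apply/negP; apply: yk.
Qed.

(* The distance truncated at 2; for graphs of diameter at most 2 it is the
   distance itself. *)
Definition gdist2 (x y : T) : nat := (x != y) + ((x != y) && ~~ e x y).

Lemma gdist2_le x y : (gdist2 x y <= gdist e x y)%N.
Proof.
rewrite /gdist2; have [->//|xy] := eqVneq x y.
have T2 : (1 < #|T|)%N by apply/card_gt1P; exists x, y.
have ball0 : y \notin ball e x 0 by rewrite inE eq_sym.
have [exy|nexy] /= := boolP (e x y); apply: gdist_ge => //; first by apply: leq_trans T2.
  by case.
case=> [|[|//]] _ //; rewrite /= !inE negb_or eq_sym xy /=.
by apply/existsPn => z; rewrite inE; apply/andP => -[/eqP->]; apply/negP.
Qed.

(** Recovers adjacency from distances, so that equal distances yield an isomorphism. *)
Lemma gdist_eq1 x y : x != y -> (gdist e x y == 1)%N = e x y.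
Proof.
move=> xy; have T2 : (1 < #|T|)%N by apply/card_gt1P; exists x, y.
have := gdist2_le x y; rewrite /gdist2 xy /=; case: (boolP (e x y)) => exy /= ge; last first.
  by apply/negbTE; rewrite gtn_eqF.
rewrite eqn_leq ge andbT; apply: gdist_le => //.
by apply: ball_step exy; rewrite inE.
Qed.

Lemma gdist_diam2 x y :
  (2 < #|T|)%N -> (x != y -> ~~ e x y -> exists z, e x z && e z y) ->
  gdist e x y = gdist2 x y.
Proof.
move=> T3 mid; apply/eqP; rewrite eqn_leq gdist2_le andbT /gdist2.
have x0 : x \in ball e x 0 by rewrite inE.
have [<-|xy] /= := eqVneq x y; first by apply: gdist_le => //; apply: leq_trans T3.
have [exy|nexy] /= := boolP (e x y).
  by apply: gdist_le; [apply: leq_trans T3 | apply: ball_step exy].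
have [z /andP[xz zy]] := mid xy nexy.
by apply: gdist_le => //; apply: ball_step zy; apply: ball_step xz.
Qed.

Definition nonnbr x := [set y | (y != x) && ~~ e x y].

Lemma sum_gdist2 x : (\sum_y gdist2 x y = #|T|.-1 + #|nonnbr x|)%N.
Proof.
rewrite big_split -(cardC1 x) -!sum1_card; congr (_ + _)%N.
  by rewrite [RHS]big_mkcond; apply: eq_bigr => y _; rewrite inE /= eq_sym; case: eqP.
by rewrite [RHS]big_mkcond; apply: eq_bigr => y _; rewrite inE eq_sym; case: andP.
Qed.

End Distance.

(** * Isolated vertices, odd components and non-neighbours outside [S] *)

Section Components.
Variables (T : finType) (e : rel T) (S : {set T}).
Hypothesis eC : symmetric e.

Definition isoset := [set x | (x \notin S) && [forall y, (y \notin S) ==> ~~ e x y]].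
Definition oddset := [set C in comps e S | odd #|C| && (3 <= #|C|)%N].
Definition component x := [set y | (y \notin S) && connect (delS e S) x y].

Lemma isosetP x : reflect (x \notin S /\ forall y, y \notin S -> ~~ e x y) (x \in isoset).
Proof.
rewrite inE; apply: (iffP andP) => -[xS /= h]; split=> //.
  by move=> y yS; have /forallP/(_ y) := h; rewrite yS.
by apply/forallP => y; apply/implyP; apply: h.
Qed.

Lemma delS_sym : connect_sym (delS e S).
Proof. by apply: sym_connect_sym => x y; rewrite /delS eC [(x \notin S) && _]andbC. Qed.

Lemma compsE C x : C \in comps e S -> x \in C -> C = component x.
Proof.
case/imsetP=> z _ ->; rewrite inE => /andP[_ zx].
by apply/setP=> y; rewrite !inE (same_connect delS_sym zx).
Qed.

Lemma trivIset_comps : trivIset (comps e S).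
Proof.
apply/trivIsetP => A B Ac Bc; apply: contraNT => /pred0Pn[x /andP[xA xB]].
by rewrite (compsE Ac xA) (compsE Bc xB).
Qed.

Lemma isoset_oddset x C : C \in oddset -> x \in C -> x \notin isoset.
Proof.
rewrite inE => /and3P[Cc _ C3] xC; apply/negP => /isosetP[xS xe].
suff /subset_leq_card : C \subset [set x] by rewrite cards1 leqNgt (leq_trans _ C3).
rewrite (compsE Cc xC); apply/subsetP => y; rewrite !inE => /andP[yS].
case/connectP=> -[|z p] /=; first by move=> _ ->.
by case/andP; rewrite /delS => /and3P[xz _ zS]; have := xe z zS; rewrite xz.
Qed.

Lemma oddset_sub : cover oddset \subset ~: S :\: isoset.
Proof.
apply/subsetP => x /bigcupP[C Co xC]; rewrite in_setD (isoset_oddset Co xC) inE.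
by move: Co; rewrite inE => /andP[Cc _]; have := xC; rewrite {1}(compsE Cc xC) inE => /andP[].
Qed.

Lemma card_cover_oddset (F : {set {set T}}) : F \subset oddset -> (3 * #|F| <= #|cover F|)%N.
Proof.
move=> Fo; have tF : trivIset F.
  apply: trivIsetS trivIset_comps; apply: subset_trans Fo _.
  by apply/subsetP => C; rewrite inE => /andP[].
rewrite -(eqP tF) mulnC -sum_nat_const; apply: leq_sum => C /(subsetP Fo).
by rewrite inE => /and3P[].
Qed.

Lemma card_outside : (#|S| + #|~: S :\: isoset| + #|isoset| = #|T|)%N.
Proof.
have sub : isoset \subset ~: S by apply/subsetP => x; rewrite !inE => /andP[].
by rewrite -addnA [(_ + #|isoset|)%N]addnC -{1}(setIidPr sub) cardsID cardsC.
Qed.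

Lemma nonnbr_iso x : x \in isoset -> (#|T| - #|S| - 1 <= #|nonnbr e x|)%N.
Proof.
case/isosetP=> xS xe; have -> : (#|T| - #|S| - 1 = #|~: S :\ x|)%N.
  have := cardsD1 x (~: S); rewrite inE xS; have := cardsC S; lia.
by apply: subset_leq_card; apply/subsetP => y; rewrite !inE => /andP[-> /xe].
Qed.

(** Such an [x] misses every isolated vertex and every odd component other than its own, each of at
    least 3 vertices. *)
Lemma nonnbr_other x : x \in ~: S :\: isoset ->
  (#|isoset| + 3 * (#|oddset| - 1) <= #|nonnbr e x|)%N.
Proof.
rewrite in_setD in_setC => /andP[xI xS].
set F := oddset :\ component x.
have Fo : F \subset oddset by apply: subD1set.
have FI : [disjoint isoset & cover F].
  rewrite -setI_eq0; apply/eqP/setP => y; rewrite !inE.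
  apply/negP => /andP[yI /bigcupP[C CF yC]].
  by have := isoset_oddset (subsetP Fo _ CF) yC; rewrite inE yI.
(* Nothing is removed when the component of [x] is not in [oddset], hence an inequality. *)
have le1 : (#|oddset| - 1 <= #|F|)%N.
  by rewrite (cardsD1 (component x) oddset) leq_subLR leq_add2r leq_b1.
apply: (@leq_trans #|isoset :|: cover F|).
  rewrite cardsU (disjoint_setI0 FI) cards0 subn0. rewrite leq_add2l.
  by apply: leq_trans (card_cover_oddset Fo); rewrite leq_mul2l.
apply: subset_leq_card; apply/subsetP => y; rewrite in_setU => /orP[yI|].
  rewrite inE; apply/andP; split; first by apply: contraNneq xI => <-.
  by rewrite eC; case/isosetP: yI => _; apply.
case/bigcupP => C /setD1P[Cx]; rewrite inE => /andP[Cc _] yC.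
rewrite inE; apply/andP; split.
  by apply: contra_neq Cx => yx; rewrite (compsE Cc yC) yx.
apply: contra_neqN Cx => exy; rewrite (compsE Cc yC).
have yS : y \notin S by have := yC; rewrite {1}(compsE Cc yC) inE => /andP[].
apply/setP => z; rewrite !inE; congr (_ && _); apply: same_connect; first exact: delS_sym.
by rewrite delS_sym; apply: connect1; rewrite /delS exy xS yS.
Qed.

(** Sums the two previous bounds over the vertices outside [S]. The constant [c] is 0 when the
    isolated vertices suffice, and 6 when there are at least three odd components. *)
Lemma sum_nonnbr c :
  (c <= 3 * (#|oddset| - 1))%N ->
  (#|isoset| * (#|T| - #|S| - 1) + (#|T| - #|S| - #|isoset|) * (#|isoset| + c)
   <= \sum_x #|nonnbr e x|)%N.
Proof.
move=> c_le; have -> : (#|T| - #|S| - #|isoset| = #|~: S :\: isoset|)%N.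
  by have := card_outside; lia.
apply: (@leq_trans (\sum_(x in ~: S) #|nonnbr e x|)); last first.
  by rewrite [leqRHS](bigID (mem (~: S))) leq_addr.
rewrite (bigID (mem isoset)) /= -!sum_nat_const; apply: leq_add.
  rewrite [leqRHS](eq_bigl (mem isoset)); last first.
    by move=> x /=; rewrite !inE andb_idl // => /andP[].
  by apply: leq_sum => x /nonnbr_iso.
rewrite [leqRHS](eq_bigl (mem (~: S :\: isoset))); last first.
  by move=> x /=; rewrite in_setD andbC.
by apply: leq_sum => x /nonnbr_other; lia.
Qed.

End Components.

(** * Distance eigenvalues of the extremal graphs *)

Section DistanceSpectrum.
Local Open Scope ring_scope.
Variable R : realType.

Lemma lambda1_ge_nonnbr (T : finType) (e : rel T) : symmetric e -> (0 < #|T|)%N ->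
  (#|T| * #|T|.-1 + \sum_x #|nonnbr e x|)%:R <= lambda1 (distmx R e) * #|T|%:R.
Proof.
move=> eC T0; have := @rayleigh R T (fun x y => (gdist e x y)%:R) T0
  (fun x y => congr1 _ (gdistC eC x y)) (fun=> 1).
rewrite [X in _ <= _ * X](eq_bigr (fun=> 1)) => [|x _]; last by rewrite expr1n.
rewrite [X in _ <= _ * X]sumr_const; apply: le_trans.
have -> : (#|T| * #|T|.-1 + \sum_x #|nonnbr e x| = \sum_x \sum_y gdist2 e x y)%N.
  under [RHS]eq_bigr => x _ do rewrite sum_gdist2.
  by rewrite big_split sum_nat_const.
rewrite natr_sum; apply: ler_sum => x _; rewrite natr_sum; apply: ler_sum => y _.
by rewrite !mulr1 ler_nat gdist2_le.
Qed.

(** As [h] has diameter at most 2, its distances are the truncated ones, which can only grow when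
    edges are deleted. Equal eigenvalues force equal distances, and adjacency is distance 1. *)
Lemma lambda1_spanning (T T' : finType) (e : rel T) (h : rel T') (f : T -> T') :
  bijective f -> symmetric e -> irreflexive e -> symmetric h -> irreflexive h ->
  (2 < #|T|)%N ->
  (forall x y, x != y -> ~~ h x y -> exists z, h x z && h z y) ->
  (forall x y, e x y -> h (f x) (f y)) ->
  lambda1 (distmx R h) <= lambda1 (distmx R e) /\
  (lambda1 (distmx R e) <= lambda1 (distmx R h) -> forall x y, h (f x) (f y) = e x y).
Proof.
move=> bf eC eI hC hI T3 mid eh; have T'3 : (2 < #|T'|)%N by rewrite -(bij_eq_card bf).
have [g fK gK] := bf; have bg : bijective g by exists f.
have le : forall x y, (gdist h x y <= gdist e (g x) (g y))%N.
  move=> x y; rewrite gdist_diam2 //; last exact: mid.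
  apply: leq_trans (gdist2_le _ _ _); rewrite /gdist2 (bij_eq bg).
  have [//|xy] /= := eqVneq x y; rewrite leq_add2l.
  by case: (boolP (e _ _)) => [/eh|_]; [rewrite !gK => -> | case: (h x y)].
have [||||||mono eqd] := @lambda1_lt_mono R T T' (fun x y => (gdist e x y)%:R)
    (fun x y => (gdist h x y)%:R) g bg.
- exact: leq_trans T3.
- by move=> x y; rewrite gdistC.
- by move=> x y; rewrite gdistC.
- by move=> x y.
- move=> x y xy; rewrite ltr0n; apply: leq_trans (gdist2_le e x y).
  by rewrite /gdist2 xy.
- by move=> x y; rewrite ler_nat.
split=> [|/eqd eqd' x y]; first exact: mono.
have [<-|xy] := eqVneq x y; first by rewrite eI hI.
have T1 : (1 < #|T'|)%N by apply: leq_trans T'3.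
rewrite -(gdist_eq1 e xy) -(@gdist_eq1 _ h) ?(bij_eq bf) //.
by have /eqP := eqd' (f x) (f y); rewrite eqr_nat !fK => /eqP ->.
Qed.

(** Evaluates a block of a distance row on which the summand is constant off the diagonal; the
    subtracted Boolean discounts [x] when it lies in the block. *)
Lemma sum_neq (p q x : nat) (c : R) :
  \sum_(p <= y < q) (x != y)%:R * c = ((q - p) - (p <= x < q))%:R * c.
Proof.
rewrite -mulr_suml -natr_sum; congr (_%:R * _).
rewrite -[(q - p)%N]muln1 -sum_nat_const_nat.
have -> : ((p <= x < q) = \sum_(p <= y < q) (x == y) :> nat)%N.
  rewrite [RHS](eq_bigr (fun y => if y == x then 1%N else 0%N)); last first.
    by move=> y _; rewrite eq_sym; case: eqP.
  by rewrite -big_mkcond big_nat1_eq; case: ifP.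
by rewrite -sumnB => [|y _]; [apply: eq_bigr => y _; case: eqP | case: eqP].
Qed.

(** * The distance matrix of K_1 v (K_{n-2} u K_1) *)

Section KK.
Variable n : nat.
Hypothesis n_ge3 : (3 <= n)%N.
Local Notation KK := (KK_graph n).

Lemma KK_sym : symmetric KK.
Proof. by move=> x y; rewrite /KK_graph eq_sym orbC. Qed.

Lemma KK_irr : irreflexive KK.
Proof. by move=> x; rewrite /KK_graph eqxx. Qed.

Lemma KK_diam2 x y : x != y -> ~~ KK x y -> exists z, KK x z && KK z y.
Proof.
have n0 : (0 < n)%N by apply: leq_trans n_ge3.
move=> xy; rewrite /KK_graph xy /= negbK => h; exists (Ordinal n0).
rewrite -!val_eqE /=; move: h xy; rewrite -val_eqE /=; lia.
Qed.

Variables a b c : R.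
(** Vectors constant on the cells of an equitable partition: pendant vertex, centre, remaining
    clique. [KK_row] is the quotient of the distance matrix applied to [(a, b, c)]. *)
Definition KK_vec (y : nat) := if y == n.-1 then a else if y == 0%N then b else c.
Definition KK_row (x : nat) :=
  if x == n.-1 then b + 2 * (n - 2)%:R * c
  else if x == 0%N then a + (n - 2)%:R * c else 2 * a + b + (n - 3)%:R * c.

Lemma KK_rowE (x : 'I_n) : \sum_(y : 'I_n) (gdist KK x y)%:R * KK_vec y = KK_row x.
Proof.
(* [gdist2] transported to natural numbers, so that the sum can be split along an interval. *)
pose D (x y : nat) := ((x != y) + ((x != y) && ~~ ((x != y) &&
    ~~ (((x == n.-1) && (y != 0%N)) || ((y == n.-1) && (x != 0%N))))))%N.
transitivity (\sum_(0 <= y < n) (D x y)%:R * KK_vec y).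
  rewrite big_mkord; apply: eq_bigr => y _.
  by rewrite gdist_diam2 ?card_ord //; apply: KK_diam2.
have [m nE] : exists m, n = m.+3 by exists (n - 3)%N; lia.
move: (nat_of_ord x) (ltn_ord x) => {}x xn.
have -> : \sum_(0 <= y < n) (D x y)%:R * KK_vec y = (D x 0)%:R * KK_vec 0
    + \sum_(1 <= y < m.+2) (D x y)%:R * KK_vec y + (D x m.+2)%:R * KK_vec m.+2.
  by rewrite nE big_nat_recr // big_ltn.
(* The factor is 2 exactly when [x] is the pendant vertex, at distance 2 from this whole block. *)
have -> : \sum_(1 <= y < m.+2) (D x y)%:R * KK_vec y =
  \sum_(1 <= y < m.+2) (x != y)%:R * ((1 + (x == m.+2))%:R * c).
  rewrite big_nat [RHS]big_nat; apply: eq_bigr => y yr.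
  rewrite mulrA -natrM /KK_vec /D nE /=; case: ifP => [|_]; first by lia.
  case: ifP => [|_]; first by lia.
  by congr (_%:R * _); lia.
rewrite sum_neq /KK_vec /KK_row /D nE /=.
have [->|xm] := eqVneq x m.+2.
  rewrite ?eqxx /=.
  have -> : (m.+2 - 1 - (m.+2 < m.+2) = m.+1)%N by rewrite ltnn subn0 subn1.
  have -> : (m.+3 - 2 = m.+1)%N by rewrite subn2.
  by rewrite !addn0 mul1r mul0r addr0 mulrCA mulrA.
have [->|x0] := eqVneq x 0%N.
  rewrite ?eqxx /=.
  have -> : (m.+2 - 1 - 0 = m.+1)%N by rewrite subn0 subn1.
  have -> : (m.+3 - 2 = m.+1)%N by rewrite subn2.
  by rewrite !addn0 !mul1r mul0r add0r addrC.
rewrite ?eqxx /=.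
have -> : (m.+2 - 1 - (0 < x < m.+2) = m)%N.
  rewrite lt0n x0 ltn_neqAle xm; move: xn; rewrite nE ltnS => -> /=.
  by rewrite subn1 subn1.
have -> : (m.+3 - 3 = m)%N by rewrite -[m.+3]addn3 addnK.
by rewrite !addn0 !mul1r addrC addrA.
Qed.

Lemma lambda1_KK_le mu : 0 < a -> 0 < b -> 0 < c ->
  b + 2 * (n - 2)%:R * c <= mu * a -> a + (n - 2)%:R * c <= mu * b ->
  2 * a + b + (n - 3)%:R * c <= mu * c -> lambda1 (distmx R KK) <= mu.
Proof.
move=> a0 b0 c0 ha hb hc.
apply: (@lambda1_le R _ (fun x y => (gdist KK x y)%:R) _ _ (fun x => KK_vec x)).
- by rewrite card_ord; apply: leq_trans n_ge3.
- by move=> x y; rewrite gdistC //; apply: KK_sym.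
- by move=> x; rewrite /KK_vec; case: ifP => // _; case: ifP.
- by [].
by move=> x; rewrite KK_rowE /KK_row /KK_vec; case: ifP => // _; case: ifP.
Qed.

Lemma lambda1_KK_ge mu : 0 < a -> 0 < b -> 0 < c ->
  mu * a <= b + 2 * (n - 2)%:R * c -> mu * b <= a + (n - 2)%:R * c ->
  mu * c <= 2 * a + b + (n - 3)%:R * c -> mu <= lambda1 (distmx R KK).
Proof.
move=> a0 b0 c0 ha hb hc.
apply: (@lambda1_ge R _ (fun x y => (gdist KK x y)%:R) _ _ (fun x => KK_vec x)).
- by rewrite card_ord; apply: leq_trans n_ge3.
- by move=> x y; rewrite gdistC //; apply: KK_sym.
- by move=> x; rewrite /KK_vec; case: ifP => // _; case: ifP.
by move=> x; rewrite KK_rowE /KK_row /KK_vec; case: ifP => // _; case: ifP.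
Qed.

End KK.

(** * The distance matrix of S_{n,k} *)

Section SG.
Variables n k : nat.
Hypotheses (k_gt0 : (0 < k)%N) (kn : (k <= n)%N).
Local Notation SG := (S_graph n k).

Lemma SG_sym : symmetric SG.
Proof. by move=> x y; rewrite /S_graph eq_sym orbC. Qed.

Lemma SG_irr : irreflexive SG.
Proof. by move=> x; rewrite /S_graph eqxx. Qed.

Lemma SG_diam2 x y : x != y -> ~~ SG x y -> exists z, SG x z && SG z y.
Proof.
move=> xy; rewrite /S_graph xy /= => h; exists (Ordinal (leq_trans k_gt0 kn)).
rewrite -!val_eqE /=; move: h; lia.
Qed.

(** The test vector is [b] on the clique and [a] on the independent set; the last two hypotheses are
    the rows of the quotient matrix. *)
Lemma lambda1_SG_le (a b mu : R) : (3 <= n)%N -> 0 < a -> 0 < b ->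
  (k - 1)%:R * b + (n - k)%:R * a <= mu * b ->
  k%:R * b + 2 * (n - k - 1)%:R * a <= mu * a ->
  lambda1 (distmx R SG) <= mu.
Proof.
move=> n_ge3 a0 b0 hb ha; pose v (y : nat) := if (y < k)%N then b else a.
apply: (@lambda1_le R _ (fun x y => (gdist SG x y)%:R) _ _ (fun x => v x)).
- by rewrite card_ord; apply: leq_trans n_ge3.
- by move=> x y; rewrite gdistC //; apply: SG_sym.
- by move=> x; rewrite /v; case: ifP.
- by [].
move=> x; have xn := ltn_ord x.
pose D (x y : nat) := ((x != y) + ((x != y) && ~~ ((x != y) && ((x < k) || (y < k)))))%N.
have -> : \sum_(y : 'I_n) (gdist SG x y)%:R * v y = \sum_(0 <= y < n) (D x y)%:R * v y.
  rewrite big_mkord; apply: eq_bigr => y _.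
  by rewrite gdist_diam2 ?card_ord //; apply: SG_diam2.
rewrite (big_cat_nat (n := k)) //=.
have -> : \sum_(0 <= y < k) (D x y)%:R * v y = \sum_(0 <= y < k) (x != y :> nat)%:R * b.
  rewrite big_nat [RHS]big_nat; apply: eq_bigr => y yr.
  by rewrite /v /D; case: ifP => [_|]; [congr (_%:R * _); lia | lia].
have -> : \sum_(k <= y < n) (D x y)%:R * v y =
  \sum_(k <= y < n) (x != y :> nat)%:R * ((1 + (k <= x))%:R * a).
  rewrite big_nat [RHS]big_nat; apply: eq_bigr => y yr.
  rewrite mulrA -natrM /v /D; case: ifP => [|_]; first by lia.
  by congr (_%:R * _); lia.
rewrite !sum_neq /v leq0n xn andbT subn0 [(k <= x)%N]leqNgt; case: (ltnP x k) => xk /=.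
  by rewrite subn0 addn0 mul1r.
by rewrite subn0 mulrA [_ * 2]mulrC.
Qed.

End SG.
End DistanceSpectrum.

(** * Barriers and the extremal graphs *)

Section Embeddings.
Variables (T : finType) (e : rel T).
Hypotheses (eC : symmetric e) (eI : irreflexive e).

Lemma index_bijective (l : seq T) : uniq l -> (forall x, x \in l) ->
  exists2 f : T -> 'I_#|T|, bijective f & forall x, f x = index x l :> nat.
Proof.
move=> ul al; have sl : size l = #|T|.
  by rewrite -(card_uniqP ul); apply: eq_card => x; rewrite al.
have lt x : (index x l < #|T|)%N by rewrite -sl index_mem.
exists (fun x => Ordinal (lt x)) => //; apply: inj_card_bij; last by rewrite card_ord.
by move=> x y /(congr1 val) /= /index_inj; apply.
Qed.

(** Listing [c] first and [u] last matches the numbering of [KK_graph], whose only non-edges join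
    the last vertex to vertices other than 0. *)
Lemma spanning_KK c u : c != u -> (forall y, e u y -> y = c) ->
  exists2 f : T -> 'I_#|T|, bijective f &
    forall x y, e x y -> KK_graph #|T| (f x) (f y).
Proof.
move=> cu uc; pose l := c :: rcons (enum (~: [set c; u])) u.
have ul : uniq l.
  rewrite /= mem_rcons inE (negPf cu) mem_enum !inE eqxx /= rcons_uniq mem_enum.
  by rewrite !inE eqxx orbT enum_uniq.
have al x : x \in l.
  by rewrite inE mem_rcons inE mem_enum !inE negb_or; case: eqP => //=; case: eqP.
have [f bf fE] := index_bijective ul al; exists f => // x y exy.
have [g fK _] := bf; have fI := can_inj fK.
have fc : f c = 0 :> nat by rewrite fE /= eqxx.
have fu : f u = #|T|.-1 :> nat.
  have sl : size l = #|T| by rewrite -(card_uniqP ul); apply: eq_card => x'; rewrite al.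
  rewrite fE -sl /= (negPf cu) -cats1 index_cat mem_enum !inE eqxx orbT /= eqxx addn0.
  by rewrite size_cat addn1.
have fxu z : (f z == #|T|.-1 :> nat) = (z == u) by rewrite -fu val_eqE (inj_eq fI).
have fxc z : (f z == 0 :> nat) = (z == c) by rewrite -fc val_eqE (inj_eq fI).
rewrite /KK_graph (inj_eq fI) !fxu !fxc; apply/andP; split.
  by apply: contraTneq exy => ->; rewrite eI.
apply/negP => /orP[] /andP[/eqP zu /negP]; apply; apply/eqP; apply: uc.
  by rewrite -zu.
by rewrite -zu eC.
Qed.

(** The vertex cover [S] is listed first, so it occupies the clique indices of [S_graph]. *)
Lemma spanning_S (S : {set T}) : (forall x y, e x y -> (x \in S) || (y \in S)) ->
  exists2 f : T -> 'I_#|T|, bijective f &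
    forall x y, e x y -> S_graph #|T| #|S| (f x) (f y).
Proof.
move=> eS; pose l := enum S ++ enum (~: S).
have ul : uniq l.
  rewrite cat_uniq !enum_uniq andbT /=; apply/hasPn => x.
  by rewrite !mem_enum inE.
have al x : x \in l by rewrite mem_cat !mem_enum inE orbN.
have [f bf fE] := index_bijective ul al; exists f => // x y exy.
have [g fK _] := bf; have fI := can_inj fK.
have fS z : (f z < #|S|)%N = (z \in S).
  rewrite fE index_cat mem_enum; case: ifP => zS; first by rewrite cardE index_mem mem_enum.
  by rewrite cardE ltnNge leq_addr.
rewrite /S_graph (inj_eq fI) !fS eS // andbT.
by apply: contraTneq exy => ->; rewrite eI.
Qed.

End Embeddings.

(* Compare S with the empty set, whose value is nonnegative. *)
Lemma barrier_card (T : finType) (e : rel T) (k : nat) (S : {set T}) : odd k ->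
  k_barrier k e S -> (k * #|S| <= #|oddset e S| + k * #|isoset e S|)%N.
Proof.
move=> ok /(_ set0); rewrite /bt_value ok cards0 muln0 -/(oddset e S) -/(isoset e S).
rewrite /odd_count /iso_count -/(oddset e S) -/(isoset e S); lia.
Qed.

(** * Counting non-adjacent pairs forced by a barrier *)

Section NonadjacentPairs.
Variables (T : finType) (e : rel T) (S : {set T}).
Hypothesis eC : symmetric e.
Local Notation n := #|T|.
Local Notation s := #|S|.
Local Notation i := #|isoset e S|.
Local Notation o := #|oddset e S|.
Local Notation W := (\sum_x #|nonnbr e x|)%N.

Lemma card_lower : (s + 3 * o + i <= n)%N.
Proof.
rewrite -(card_outside e S) leq_add2r leq_add2l.
apply: leq_trans (card_cover_oddset eC (subxx (oddset e S))) _.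
exact: subset_leq_card (@oddset_sub T e S eC).
Qed.

Lemma many_isolated : (s <= i)%N ->
  [/\ (s + i <= n)%N & (i * (n - s - 1) + (n - s - i) * i <= W)%N].
Proof.
move=> le; split; first by have := card_lower; lia.
by have := @sum_nonnbr T e S eC 0; rewrite addn0; apply.
Qed.

Variable k : nat.
Hypotheses (k_ge3 : (3 <= k)%N) (S_barrier : (k * s <= o + k * i)%N).

(** The barrier inequality gives [o >= k (s - i) >= 3 (s - i)]. Hence [o >= 3], which permits
    [c = 6], and [n >= s + i + 9 (s - i) >= 10]. *)
Lemma few_isolated : (i < s)%N -> (10 <= n)%N /\ (4 * n <= W + 14)%N.
Proof.
move=> lt; have o3 : (3 * (s - i) <= o)%N.
  apply: (@leq_trans (k * (s - i))); first by rewrite leq_mul2r k_ge3 orbT.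
  by rewrite mulnBr leq_subLR addnC.
have cl := card_lower; have := @sum_nonnbr T e S eC 6.
move: o3 cl lt; move: #|S| #|isoset e S| #|oddset e S| W #|T| => s' i' o' w n' o3 cl lt Wge.
have {}Wge := Wge ltac:(lia); split; first by lia.
(* Here [t] is [s - i] and [m] counts the non-isolated vertices outside [S]; this removes truncated
   subtraction before [nia]. *)
have [t [m [nE [sE mt]]]] : exists t m,
    [/\ n' = 2 * i' + t + m, s' = i' + t & 9 * t <= m /\ 0 < t]%N.
  by exists (s' - i'), (n' - s' - i'); split; [lia|lia|lia].
move: Wge; rewrite nE sE.
have -> : (2 * i' + t + m - (i' + t) - i' = m)%N by lia.
have -> : (2 * i' + t + m - (i' + t) - 1 = i' + m - 1)%N by lia.
nia.
Qed.

End NonadjacentPairs.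

(** * Explicit eigenvalue bounds for the extremal graphs *)

Lemma lambda1_KK_upper (R : realType) (n : nat) : (12 <= n)%N ->
  (lambda1 (distmx R (KK_graph n)) <= n%:R + 2 - 14 / (n%:R + 6))%R.
Proof.
(* With weights [2 - t], 1, 1 and value [n + 2 - 2 t] the clique rows are equalities, and the
   pendant row reads [t (n + 6) <= 7 + 2 t^2]; this [t] makes the left side 7. *)
move=> n12; pose t : R := (7 / (n%:R + 6))%R.
have n12R : (12 <= n%:R :> R)%R by rewrite ler_nat.
have tE : (t * (n%:R + 6) = 7)%R by rewrite /t; field; lra.
have t0 : (0 < t)%R by rewrite /t divr_gt0 //; lra.
have t1 : (t <= 1 / 2)%R by nra.
have -> : (n%:R + 2 - 14 / (n%:R + 6) = n%:R + 2 - 2 * t :> R)%R.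
  by rewrite /t; field; lra.
have n2 : ((n - 2)%:R = n%:R - 2 :> R)%R by rewrite natrB //; lia.
have n3 : ((n - 3)%:R = n%:R - 3 :> R)%R by rewrite natrB //; lia.
apply: (@lambda1_KK_le R n _ (2 - t) 1 1)%R; rewrite ?n2 ?n3; try lia; try lra.
by nra.
Qed.

(** The target is a value below 11, the all-ones bound for [n = 10] and [W >= 20]. *)
Lemma lambda1_KK10 (R : realType) :
  (lambda1 (distmx R (KK_graph 10)) <= 1097 / 100)%R.
Proof. by apply: (@lambda1_KK_le R 10 _ 154 87 100)%R => //; rewrite ?natrB //; lra. Qed.

(** Just above the upper bound 8773/1000 for [S_graph 8 4], to separate the two graphs. *)
Lemma lambda1_KK8 (R : realType) :
  (8774 / 1000 <= lambda1 (distmx R (KK_graph 8)))%R.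
Proof. by apply: (@lambda1_KK_ge R 8 _ 1464 850 1000)%R => //; rewrite ?natrB //; lra. Qed.

(** The value lies below the all-ones bound 16/4; likewise below, 62/10 is less than 38/6 and
    8773/1000 less than 74/8. *)
Lemma lambda1_S4 (R : realType) : (lambda1 (distmx R (S_graph 4 2)) <= 36 / 10)%R.
Proof. by apply: (@lambda1_SG_le R 4 2 _ _ 128 100)%R => //; rewrite ?natrB //; lra. Qed.

Lemma lambda1_S6 (R : realType) : (lambda1 (distmx R (S_graph 6 3)) <= 62 / 10)%R.
Proof. by apply: (@lambda1_SG_le R 6 3 _ _ 139 100)%R => //; rewrite ?natrB //; lra. Qed.

Lemma lambda1_S8 (R : realType) : (lambda1 (distmx R (S_graph 8 4)) <= 8773 / 1000)%R.
Proof. by apply: (@lambda1_SG_le R 8 4 _ _ 101 70)%R => //; rewrite ?natrB //; lra. Qed.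

(** * From a non-empty barrier to the extremal graph *)

Section Extremal.
Variables (R : realType) (T : finType) (e : rel T) (k : nat) (S : {set T}).
Hypotheses (eC : symmetric e) (eI : irreflexive e).
Hypotheses (k_ge3 : (3 <= k)%N) (S_neq0 : S != set0).
Hypothesis S_barrier : (k * #|S| <= #|oddset e S| + k * #|isoset e S|)%N.
Hypotheses (n_even : ~~ odd #|T|) (n_ge4 : (4 <= #|T|)%N).
Local Notation W := (\sum_x #|nonnbr e x|)%N.

Lemma spanning_KK_barrier : #|S| = 1%N -> (0 < #|isoset e S|)%N ->
  exists2 f : T -> 'I_#|T|, bijective f &
    forall x y, e x y -> KK_graph #|T| (f x) (f y).
Proof.
move=> /eqP/cards1P[c Sc] /card_gt0P[u /isosetP[uS uN]].
apply: (@spanning_KK T e eC eI c u); first by move: uS; rewrite Sc inE eq_sym.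
move=> y uy; apply/eqP; have : y \in S by apply: contraTT uy => /uN.
by rewrite Sc inE.
Qed.

Lemma spanning_S_barrier : (#|T| <= #|S| + #|isoset e S|)%N ->
  exists2 f : T -> 'I_#|T|, bijective f &
    forall x y, e x y -> S_graph #|T| #|S| (f x) (f y).
Proof.
move=> le; apply: spanning_S => // x y exy; apply: contraTT exy.
rewrite negb_or => /andP[xS yS].
have out0 : ~: S :\: isoset e S = set0.
  by apply/eqP; rewrite -cards_eq0; have := card_outside e S; lia.
have /isosetP[_ /(_ y yS) //] : x \in isoset e S.
apply: contraT => xI; have : x \in set0 by rewrite -out0 in_setD xI in_setC.
by rewrite inE.
Qed.

(** Orders 10 and 12 are separate because of [s = i = n/2]: the count [n/2 (n/2 - 1)] is then 20 or
    30, below [4 n - 14], which it reaches at 14. *)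
Lemma nonnbr_lower_ge10 : (10 <= #|T|)%N -> ~~ ((#|S| == 1%N) && (0 < #|isoset e S|)%N) ->
  [\/ #|T| = 10%N /\ (20 <= W)%N, #|T| = 12%N /\ (28 <= W)%N |
      (14 <= #|T|)%N /\ (4 * #|T| <= W + 14)%N].
Proof.
move=> n10 s2; have s0 : (0 < #|S|)%N by rewrite card_gt0.
have ne := n_even.
have [le|lt] := leqP #|S| #|isoset e S|; last first.
  have [_] := few_isolated eC k_ge3 S_barrier lt.
  move: n10 ne; move: #|T| W => n w n10 ne wn.
  have [nE|n10'] := eqVneq n 10%N; first by constructor 1; lia.
  have [nE|n12'] := eqVneq n 12%N; first by constructor 2; lia.
  by constructor 3; lia.
have [] := many_isolated eC le.
move: le n10 s2 s0 ne; move: #|S| #|isoset e S| W #|T| => s i w n le n10 s2 s0 ne sin.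
have {s2} s2 : (1 < s)%N by move: s2; lia.
have [q [nE]] : exists q, n = (s + i + q)%N by exists (n - s - i)%N; lia.
have -> : (n - s - 1 = i + q - 1)%N by lia.
have -> : (n - s - i = q)%N by lia.
move=> wE.
(* Once [i] is a numeral, the quadratic bound becomes linear and [lia] applies. *)
have i_small (m : nat) : (i <= m)%N -> i \in iota 2 (m - 1) by rewrite mem_iota; lia.
have [n14|n14] := leqP 14 n.
  constructor 3; split=> //; rewrite nE; move: wE.
  have [i7|i7] := leqP 7 i; first by nia.
  have := i_small 6 i7; rewrite /= !inE.
  by case/or4P=> [/eqP E|/eqP E|/eqP E|/orP[]/eqP E]; move: nE n14 le; rewrite E; lia.
have : n = 10%N \/ n = 12%N by lia.
case=> nn; [constructor 1|constructor 2]; split=> //; move: wE.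
  have := i_small 8 ltac:(lia); rewrite /= !inE.
  by do ![case/orP=> [/eqP E|] | move/eqP=> E]; move: nE nn le; rewrite E; lia.
have := i_small 10 ltac:(lia); rewrite /= !inE.
by do ![case/orP=> [/eqP E|] | move/eqP=> E]; move: nE nn le; rewrite E; lia.
Qed.

(** For [n = 8] and [|S| = 1] the count guarantees only [W >= 12], an average row sum of 8.5, so
    this case is left open. *)
Lemma nonnbr_lower_le8 : (#|T| <= 8)%N -> (2 * #|S| < #|T|)%N -> (#|S| <= #|isoset e S|)%N ->
  [\/ #|T| = 4 /\ (4 <= W), #|T| = 6 /\ (8 <= W) |
      #|T| = 8 /\ (#|S| = 1 \/ 18 <= W)]%N.
Proof.
move=> n8 sn le; have s0 : (0 < #|S|)%N by rewrite card_gt0.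
have ne := n_even; have n4 := n_ge4.
have [] := many_isolated eC le.
move: le n8 n4 sn s0 ne; move: #|S| #|isoset e S| W #|T| => s i w n le n8 n4 sn s0 ne sin.
have [q nE] : exists q, n = (s + i + q)%N by exists (n - s - i)%N; lia.
have -> : (n - s - 1 = i + q - 1)%N by lia.
have -> : (n - s - i = q)%N by lia.
move=> wE.
have iE : i \in iota 1 7 by rewrite mem_iota; lia.
have : n = 4 \/ n = 6 \/ n = 8 by lia.
case=> [nn|[nn|nn]]; [constructor 1|constructor 2|constructor 3]; split=> //; move: wE iE;
  rewrite /= !inE => wE;
  by do ![case/orP=> [/eqP E|] | move/eqP=> E]; move: wE nE nn le; rewrite E; lia.
Qed.

Lemma barrier_iso_KK : (10 <= #|T|)%N ->
  (lambda1 (distmx R e) <= lambda1 (distmx R (KK_graph #|T|)))%R ->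
  iso_graph e (KK_graph #|T|).
Proof.
move=> n10 le; case: (boolP ((#|S| == 1%N) && (0 < #|isoset e S|)%N)).
  case/andP=> /eqP s1 i0; have [f bf ef] := spanning_KK_barrier s1 i0.
  exists f; split=> //.
  have n3 : (3 <= #|T|)%N by apply: leq_trans n10.
  have [_] := @lambda1_spanning R _ _ _ _ f bf eC eI (@KK_sym _) (@KK_irr _) n3
    (KK_diam2 n3) ef.
  exact.
move=> ns; exfalso; have T0 : (0 < #|T|)%N by apply: leq_trans n10.
have low := @lambda1_ge_nonnbr R T e eC T0.
have n_pos : (0 < #|T|%:R :> R)%R by rewrite ltr0n.
(* Every upper bound [mu] for the extremal eigenvalue yields [n (n - 1) + W <= mu n]. *)
have up mu := le_trans low (ler_wpM2r (ltW n_pos) (le_trans le mu)).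
case: (nonnbr_lower_ge10 n10 ns) => -[nE wE]; rewrite ?nE in up.
- have := up _ (lambda1_KK10 R).
  have : (110%:R <= (10 * 9 + W)%:R :> R)%R by rewrite ler_nat; lia.
  by move=> h1 h2; have := le_trans h1 h2; lra.
- have mu12 : (12%:R + 2 - 14 / (12%:R + 6) = 119 / 9 :> R)%R by field.
  have := lambda1_KK_upper R (leqnn 12); rewrite mu12 => /up.
  have : (160%:R <= (12 * 11 + W)%:R :> R)%R by rewrite ler_nat; lia.
  by move=> h1 h2; have := le_trans h1 h2; lra.
have n12 : (12 <= #|T|)%N by apply: leq_trans nE.
have := up _ (lambda1_KK_upper R n12).
have : ((#|T| * #|T| + 3 * #|T| - 14)%:R <= (#|T| * #|T|.-1 + W)%:R :> R)%R.
  by rewrite ler_nat; nia.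
rewrite natrB; last by nia.
rewrite natrD !natrM => h1 h2; have {h1 h2} := le_trans h1 h2.
have : (14 <= #|T|%:R :> R)%R by rewrite ler_nat.
move: (#|T|%:R)%R => x x14.
(* The inequality has become [x - 14 <= - x y] with [y] this quotient, which contradicts [x >= 14]
   and [y > 0]. *)
have : (0 < 14 / (x + 6))%R by rewrite divr_gt0 //; lra.
by move: (14 / (x + 6))%R => y y0; nra.
Qed.

Lemma barrier_iso_S : (#|T| <= 8)%N ->
  (lambda1 (distmx R e) <= lambda1 (distmx R (S_graph #|T| #|T|./2)))%R ->
  iso_graph e (S_graph #|T| #|T|./2).
Proof.
move=> n8 le; have ne := n_even; have n4 := n_ge4; have s0 : (0 < #|S|)%N by rewrite card_gt0.
have si : (#|S| <= #|isoset e S|)%N.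
  (* Fewer isolated vertices than [|S|] would require order at least 10. *)
  by rewrite leqNgt; apply/negP => /(few_isolated eC k_ge3 S_barrier) []; lia.
have [sin _] := many_isolated eC si.
have n3 : (3 <= #|T|)%N by apply: leq_trans n4.
have [sn|sn] := ltnP (2 * #|S|)%N #|T|; last first.
  have sE : #|S| = #|T|./2 by lia.
  have [|f bf ef] := spanning_S_barrier; first by lia.
  rewrite sE in ef; exists f; split=> //.
  have h0 : (0 < #|T|./2)%N by lia.
  have hn : (#|T|./2 <= #|T|)%N by lia.
  have [_] := @lambda1_spanning R _ _ _ _ f bf eC eI (@SG_sym _ _) (@SG_irr _ _) n3
    (SG_diam2 h0 hn) ef.
  exact.
exfalso; have T0 : (0 < #|T|)%N by apply: leq_trans n4.
have low := @lambda1_ge_nonnbr R T e eC T0.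
have n_pos : (0 < #|T|%:R :> R)%R by rewrite ltr0n.
have up mu := le_trans low (ler_wpM2r (ltW n_pos) (le_trans le mu)).
case: (nonnbr_lower_le8 n8 sn si) => -[nE wE]; rewrite nE /= in up.
- have := up _ (lambda1_S4 R).
  have : (16%:R <= (4 * 3 + W)%:R :> R)%R by rewrite ler_nat; lia.
  by move=> h1 h2; have := le_trans h1 h2; lra.
- have := up _ (lambda1_S6 R).
  have : (38%:R <= (6 * 5 + W)%:R :> R)%R by rewrite ler_nat; lia.
  by move=> h1 h2; have := le_trans h1 h2; lra.
case: wE => [s1|wE]; last first.
  have := up _ (lambda1_S8 R).
  have : (74%:R <= (8 * 7 + W)%:R :> R)%R by rewrite ler_nat; lia.
  by move=> h1 h2; have := le_trans h1 h2; lra.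
(* In the open case the graph spans a subgraph of K_1 v (K_6 u K_1), so monotonicity would give
   8.774 <= 8.773. *)
have [f bf ef] := spanning_KK_barrier s1 (leq_trans s0 si).
have [KKle _] := @lambda1_spanning R _ _ _ _ f bf eC eI (@KK_sym _) (@KK_irr _) n3
    (KK_diam2 n3) ef.
have := le_trans KKle le; rewrite nE /= => h.
have := le_trans (lambda1_KK8 R) (le_trans h (lambda1_S8 R)); lra.
Qed.

End Extremal.

Theorem theorem4 (R : realType) (k : nat) (T : finType) (e : rel T) :
  symmetric e -> irreflexive e ->
  (3 <= k)%N -> odd k ->
  connected_graph e -> ~~ odd #|T| -> (4 <= #|T|)%N ->
  ((10 <= #|T|)%N ->
     (lambda1 (distmx R e) <= lambda1 (distmx R (KK_graph #|T|)))%R ->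
     ~ iso_graph e (KK_graph #|T|) -> GBC k e) /\
  ((#|T| <= 8)%N ->
     (lambda1 (distmx R e) <= lambda1 (distmx R (S_graph #|T| #|T|./2)))%R ->
     ~ iso_graph e (S_graph #|T| #|T|./2) -> GBC k e).
Proof.
move=> eC eI k3 ok con ev n4; split=> n_bound le niso; split=> // S S0 bar; apply: niso.
  exact: (barrier_iso_KK eC eI k3 S0 (barrier_card ok bar) ev n4 n_bound le).
exact: (barrier_iso_S eC eI k3 S0 (barrier_card ok bar) ev n4 n_bound le).
Qed.
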